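(* Let $\mathcal G$ be a finite groupoid and let $T\in\mathbb C\mathcal G$. Then $$\tau_{\mathcal G}(T)=\int_{\mathcal G_0}\frac{1}{|\mathcal Gx|\,|\operatorname{St}(x,\mathcal G)|}\operatorname{tr}(T_x)\,d\mu(x)=\int_{\mathcal G_0}\frac{1}{|s^*x|}\operatorname{tr}(T_x)\,d\mu(x).$$
   Context: Measurable spaces are standard Borel spaces; all sets and functions are measurable. A groupoid $\mathcal G$ is a small category all of whose morphisms are invertible; $\mathcal G_0$ is its set of objects, $\mathcal G$ also denotes its set of morphisms, and $\mathcal G_0\subset\mathcal G$ via identity morphisms. $s,r\colon\mathcal G\to\mathcal G_0$ are source and range; the composition of $\gamma\colon x\to y$ and $\gamma'\colon y\to z$ is written $\gamma\gamma'\colon x\to z$; $i(\gamma)=\gamma^{-1}$. $s^*x:=s^{-1}(x)$; the orbit $\mathcal Gx$ is the set of $y$ admitting a morphism from $x$; $\operatorname{St}(x,\mathcal G)=\{\alpha\in\mathcal G: s(\alpha)=r(\alpha)=x\}$. All groupoids are discrete measured: $\mathcal G$ is a measurable space, $\mathcal G_0$ a measurable subset, $s,r$ have countable fibers, the structure maps are measurable, and $\mathcal G_0$ carries a (finite) measure $\mu$ such that $U\mapsto\int_{\mathcal G_0}|r^{-1}(x)\cap U|\,d\mu(x)$ and $U\mapsto\int_{\mathcal G_0}|s^{-1}(x)\cap U|\,d\mu(x)$ coincide; this measure on $\mathcal G$ is also denoted $\mu$, and $L^2(\mathcal G)$ is taken with respect to it. A measurable edge is a map $\phi\colon \operatorname{Dom}(\phi)\to\mathcal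 G$, $\operatorname{Dom}(\phi)\subset\mathcal G_0$, such that $s\circ\phi$ is the inclusion and $r\circ\phi$ is injective. Its inverse $\phi^{-1}$ has domain $r(\operatorname{Im}\phi)$ and $\phi^{-1}(r(\phi(x)))=i(\phi(x))$. A measurable edge acts on $L^2(\mathcal G)$ by $\phi(F)(\gamma)=F(\gamma\,\phi^{-1}(r(\gamma)))$ if $r(\gamma)\in\operatorname{Dom}(\phi^{-1})$ and $0$ otherwise; $f\in L^\infty(\mathcal G_0)$ acts by $f(F)(\gamma)=f(r(\gamma))F(\gamma)$. The groupoid ring $\mathbb C\mathcal G$ is the ring of bounded operators on $L^2(\mathcal G)$ generated by measurable edges and $L^\infty(\mathcal G_0)$; each of its elements is a finite sum $T=\sum_i\phi_if_i$ with $\phi_i$ measurable edges and $f_i\in L^\infty(\mathcal G_0)$. The trace is $\tau_{\mathcal G}(T)=\langle T\chi_0,\chi_0\rangle_{L^2(\mathcal G)}$, $\chi_0$ the characteristic function of $\mathcal G_0\subset\mathcal G$. For $T=\sum_i\phi_if_i$ and $x\in\mathcal G_0$, $T_x\colon l^2(s^*x)\to l^2(s^*x)$ is the operator (the convolution operator on the Cayley diagram of $x$) given on the standard basis vectors by $T_x\zeta_\alpha=\sum_{i:\ r(\alpha)\in\operatorname{Dom}(\phi_i)}f_i(r(\alpha))\,\zeta_{\alpha\,\phi_i(r(\alpha))}$. $\mathcal G$ is finite if $s^*x$ is finite for almost all $x$. $\operatorname{tr}$ is the usual (non-normalized) trace. *)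

(* Defs.v *)
From HB Require Import structures.
From mathcomp Require Import all_boot all_order all_algebra.
From mathcomp Require Import finmap complex.
From mathcomp Require Import all_classical all_reals all_analysis.
From mathcomp Require Import measurable_realfun.

Set Implicit Arguments.
Unset Strict Implicit.
Unset Printing Implicit Defensive.

Import Order.TTheory GRing.Theory Num.Theory.
Import numFieldNormedType.Exports.

Local Open Scope classical_set_scope.
Local Open Scope ring_scope.

Definition standard_borel (R : realType) d (T : measurableType d) : Prop :=
  exists (P : metricType R) (h : T -> P),
    [/\ forall F : set_system P, ProperFilter F -> cauchy F -> exists p : P, F --> p,
        @second_countable P, bijective h &
        forall A : set T, measurable A <-> <<s @open P >> (h @` A)].

(* [0] on infinite sets, so that [(ncard A)%:R^-1 = 0] there. *)
Definition ncard (T : choiceType) (A : set T) : nat := #|` fset_set A |.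

(* Complex-valued functions are measured and integrated componentwise. *)
Section complex_integral.
Context d (T : measurableType d) (R : realType).

Definition cmeasurable (D : set T) (F : T -> R[i]) : Prop :=
  measurable_fun D (fun t => complex.Re (F t)) /\ measurable_fun D (fun t => complex.Im (F t)).

Definition cintegrable (mu : {measure set T -> \bar R}) (F : T -> R[i]) : Prop :=
  mu.-integrable setT (fun t => (complex.Re (F t))%:E) /\
  mu.-integrable setT (fun t => (complex.Im (F t))%:E).

Definition cintegral (mu : {measure set T -> \bar R}) (F : T -> R[i]) : R[i] :=
  Complex (\int[mu]_t complex.Re (F t)) (\int[mu]_t complex.Im (F t)).

End complex_integral.

(* [gcomp g h] is the composite "first [g], then [h]"; its value is irrelevant
   unless [rng g = src h]. *)
Record groupoid (X G : Type) := Groupoid {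
  src : G -> X;
  rng : G -> X;
  gid : X -> G;
  gcomp : G -> G -> G;
  ginv : G -> G;
  src_gid : forall x, src (gid x) = x;
  rng_gid : forall x, rng (gid x) = x;
  src_gcomp : forall g h, rng g = src h -> src (gcomp g h) = src g;
  rng_gcomp : forall g h, rng g = src h -> rng (gcomp g h) = rng h;
  gcompA : forall g h k, rng g = src h -> rng h = src k ->
    gcomp g (gcomp h k) = gcomp (gcomp g h) k;
  gcomp_gidl : forall g, gcomp (gid (src g)) g = g;
  gcomp_gidr : forall g, gcomp g (gid (rng g)) = g;
  src_ginv : forall g, src (ginv g) = rng g;
  rng_ginv : forall g, rng (ginv g) = src g;
  gcomp_ginvr : forall g, gcomp g (ginv g) = gid (src g);
  gcomp_ginvl : forall g, gcomp (ginv g) g = gid (rng g) }.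

Definition sfiber (X G : Type) (gr : groupoid X G) (x : X) : set G :=
  [set g | src gr g = x].

Definition rfiber (X G : Type) (gr : groupoid X G) (x : X) : set G :=
  [set g | rng gr g = x].

Definition gorbit (X G : Type) (gr : groupoid X G) (x : X) : set X :=
  rng gr @` sfiber gr x.

Definition gstab (X G : Type) (gr : groupoid X G) (x : X) : set G :=
  sfiber gr x `&` rfiber gr x.

(* The objects form a type [X] of their own, embedded into the morphisms by
   [gid]. Since [src] is a measurable retraction of [gid], the sigma-algebra
   of [X] is the trace of the one of [G] on the measurable set [range gid].
   [measurable_scount] says that the integrand of the measure on [G] is
   measurable; for standard Borel spaces it is automatic (Lusin-Novikov), and
   composing with [ginv] gives the same for [rfiber]. *)
Record dm_groupoid (R : realType) dX dG
    (X : measurableType dX) (G : measurableType dG) := DMGroupoid {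
  gpd :> groupoid X G;
  obj_measure : {finite_measure set X -> \bar R};
  standard_obj : standard_borel R X;
  standard_mor : standard_borel R G;
  measurable_src : measurable_fun setT (src gpd);
  measurable_rng : measurable_fun setT (rng gpd);
  measurable_gid : measurable_fun setT (gid gpd);
  measurable_range_gid : measurable (range (gid gpd));
  measurable_ginv : measurable_fun setT (ginv gpd);
  measurable_gcomp : measurable_fun
    [set gh : G * G | rng gpd gh.1 = src gpd gh.2]
    (fun gh => gcomp gpd gh.1 gh.2);
  countable_sfiber : forall x, countable (sfiber gpd x);
  countable_rfiber : forall x, countable (rfiber gpd x);
  measurable_scount : forall U : set G, measurable U ->
    measurable_fun setT ((fun x => counting (sfiber gpd x `&` U)) : X -> \bar R);
  measure_invariant : forall U : set G, measurable U ->
    (\int[obj_measure]_x counting (rfiber gpd x `&` U) =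
     \int[obj_measure]_x counting (sfiber gpd x `&` U))%E }.

Section morphism_measure.
Context (R : realType) dX dG (X : measurableType dX) (G : measurableType dG).
Variable gr : dm_groupoid R X G.

Definition mor_measure (U : set G) : \bar R :=
  (\int[obj_measure gr]_x counting (sfiber gr x `&` U))%E.

Local Open Scope ereal_scope.

Lemma counting_bigcup (F : (set G)^nat) : trivIset setT F ->
  counting (\bigcup_n F n) = \sum_(n <oo) counting (F n) :> \bar R.
Proof.
move=> tF; pose D := g_sigma_algebraType [set: set G].
have mD (A : set D) : measurable A by exact: sub_gen_smallest.
exact: (@measure_semi_bigcup _ R D (@counting D R) F
  (fun i => mD (F i)) tF (mD _)).
Qed.

Let mor_measure0 : mor_measure set0 = 0.
Proof.
apply: integral0_eq => x _.
by rewrite setI0 /counting asboolT// fset_set0.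
Qed.

Let counting_ge0 (A : set G) : 0 <= counting A :> \bar R.
Proof. by rewrite /counting; case: ifPn; rewrite ?lee_fin// lee_pinfty. Qed.

Let mor_measure_ge0 U : 0 <= mor_measure U.
Proof. by apply: integral_ge0 => x _; exact: counting_ge0. Qed.

Let mor_measure_semi_sigma_additive : semi_sigma_additive mor_measure.
Proof.
move=> F mF tF mU; rewrite /mor_measure.
under eq_integral => x _.
  rewrite setI_bigcupr counting_bigcup; last exact: trivIset_setIl.
  over.
rewrite integral_nneseries//=; last first.
  by move=> n; apply: measurable_scount.
apply: is_cvg_ereal_nneg_natsum_cond => n _ _.
exact: mor_measure_ge0.
Qed.

HB.instance Definition _ := isMeasure.Build _ G R mor_measure
  mor_measure0 mor_measure_ge0 mor_measure_semi_sigma_additive.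

End morphism_measure.

Section operators.
Context (R : realType) dX dG (X : measurableType dX) (G : measurableType dG).
Variable gr : dm_groupoid R X G.

Local Notation mu := (obj_measure gr).
Local Notation muG := (mor_measure gr).

Definition finite_groupoid : Prop := {ae mu, forall x, finite_set (sfiber gr x)}.

(* Vectors of L^2(G) are handled through their representatives, and operators
   on L^2(G) as maps of functions, compared by [L2_op_eq]. *)
Definition L2 (F : G -> R[i]) : Prop :=
  cmeasurable setT F /\
  (\int[muG]_g ((Normc.normc (F g)) ^+ 2)%:E < +oo)%E.

Definition L2_dot (F H : G -> R[i]) : R[i] :=
  cintegral muG (fun g => F g * conjc (H g)).

Definition L2_op_eq (S T : (G -> R[i]) -> G -> R[i]) : Prop :=
  forall F, L2 F -> S F = T F %[ae muG].

Definition Linfty (f : X -> R[i]) : Prop :=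
  cmeasurable setT f /\
  exists M : R, {ae mu, forall x, Normc.normc (f x) <= M}.

(* The values of [edge_fun] outside [edge_dom] are irrelevant. *)
Record measurable_edge := MeasurableEdge {
  edge_dom : set X;
  edge_fun :> X -> G;
  measurable_edge_dom : measurable edge_dom;
  measurable_edge_fun : measurable_fun edge_dom edge_fun;
  src_edge : forall x, edge_dom x -> src gr (edge_fun x) = x;
  rng_edge_inj : set_inj edge_dom (fun x => rng gr (edge_fun x)) }.

Definition edge_inv_dom (phi : measurable_edge) : set X :=
  rng gr @` (phi @` edge_dom phi).

Definition edge_inv (phi : measurable_edge) (y : X) : G :=
  ginv gr (phi (pinv (edge_dom phi) (fun x => rng gr (phi x)) y)).

Definition edge_op (phi : measurable_edge) (F : G -> R[i]) (g : G) : R[i] :=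
  if rng gr g \in edge_inv_dom phi then F (gcomp gr g (edge_inv phi (rng gr g)))
  else 0.

Definition mul_op (f : X -> R[i]) (F : G -> R[i]) (g : G) : R[i] :=
  f (rng gr g) * F g.

(* The subring generated by the edges and L^oo; its zero, one and scalars are
   multiplications by constants. *)
Inductive groupoid_ring : ((G -> R[i]) -> G -> R[i]) -> Prop :=
| GR_edge phi : groupoid_ring (edge_op phi)
| GR_Linfty f : Linfty f -> groupoid_ring (mul_op f)
| GR_add S T : groupoid_ring S -> groupoid_ring T ->
    groupoid_ring (fun F g => S F g + T F g)
| GR_opp T : groupoid_ring T -> groupoid_ring (fun F g => - T F g)
| GR_mul S T : groupoid_ring S -> groupoid_ring T ->
    groupoid_ring (fun F => S (T F))
| GR_eq S T : groupoid_ring S -> L2_op_eq S T -> groupoid_ring T.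

Definition chi0 (g : G) : R[i] := (g \in range (gid gr))%:R.

Definition gtrace (T : (G -> R[i]) -> G -> R[i]) : R[i] := L2_dot (T chi0) chi0.

Section presentation.
Variables (n : nat) (phi : 'I_n -> measurable_edge) (f : 'I_n -> X -> R[i]).

Definition sum_op (F : G -> R[i]) (g : G) : R[i] :=
  \sum_(i < n) edge_op (phi i) (mul_op (f i) F) g.

Definition zeta (a b : G) : R[i] := (b == a)%:R.

Definition conv_zeta (a b : G) : R[i] :=
  \sum_(i < n | rng gr a \in edge_dom (phi i))
    f i (rng gr a) * zeta (gcomp gr a (phi i (rng gr a))) b.

(* Linear extension of [conv_zeta] to l^2(s^*x). For each [b] at most [n]
   vertices [a] contribute, because [rng \o phi i] is injective, so the sum is
   finite even when the fiber is infinite. *)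
Definition conv_op (x : X) (v : G -> R[i]) (b : G) : R[i] :=
  \sum_(a \in sfiber gr x) v a * conv_zeta a b.

End presentation.

(* Sum of the diagonal coefficients in the basis [zeta a], for [a] in [s^*x]. *)
Definition fiber_trace (x : X) (A : (G -> R[i]) -> G -> R[i]) : R[i] :=
  \sum_(a \in sfiber gr x) A (zeta a) a.

End operators.

(* Main.v *)
(* Write [T = sum_i phi_i f_i] and let [K x] be the sum of the [f_i x] over
   those [i] with [phi_i x = id_x]. Both sides only see [K]: evaluating [T chi0]
   on the units gives [tau(T) = int K], and a loop at a vertex [a] of the Cayley
   diagram arises exactly when [phi_i] is the identity at [r(a)], so
   [tr(T_x) = sum_(a in s^*x) K(r(a))]. Since [|s^*x|] is constant along orbits,
   invariance of the measure under inversion gives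
     int_X |s^*x|^-1 sum_(a in s^*x) K(r(a)) dmu(x)
       = int_G |s^*s(a)|^-1 K(r(a)) dmu(a) = int_G |s^*r(a)|^-1 K(s(a)) dmu(a)
       = int_X K dmu.
   Finally [|s^*x| = |Gx| |St(x)|] by the orbit-stabilizer bijection. *)
Require Import Defs.
From HB Require Import structures.
From mathcomp Require Import all_boot all_order all_algebra.
From mathcomp Require Import finmap complex.
From mathcomp Require Import all_classical all_reals all_analysis.
From mathcomp Require Import measurable_realfun.

Set Implicit Arguments.
Unset Strict Implicit.
Unset Printing Implicit Defensive.

Import Order.TTheory GRing.Theory Num.Theory.
Local Open Scope classical_set_scope.
Local Open Scope ring_scope.
Local Open Scope card_scope.

(** * Cardinals and counting measure *)

Lemma infinite_fset_set (T : choiceType) (A : set T) :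
  infinite_set A -> fset_set A = fset0.
Proof. by rewrite /fset_set; case: pselect. Qed.

Section cardinality.
Context (R : realType) (T U : choiceType).

Lemma card_eq_ncard (A : set T) (B : set U) : A #= B -> ncard A = ncard B.
Proof.
move=> AB; rewrite /ncard; have [fA|iA] := pselect (finite_set A).
  by apply/fcard_eq => //; rewrite -(eq_finite_set AB).
by rewrite !infinite_fset_set// -(eq_finite_set AB).
Qed.

Lemma card_eq_counting (A : set T) (B : set U) : A #= B ->
  counting A = counting B :> \bar R.
Proof.
move=> AB; rewrite /counting (eq_finite_set AB); case: ifPn => //.
by have := card_eq_ncard AB; rewrite /ncard => ->.
Qed.

(** Infinite sets are covered because [fine] sends [+oo] to 0, the default of [ncard]. This
    transfers measurability from [counting] to cardinals of fibers. *)
Lemma ncard_fine_counting (A : set T) : (ncard A)%:R = fine (counting A) :> R.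
Proof.
rewrite /counting; case: ifPn => //= /asboolPn iA.
by rewrite /ncard infinite_fset_set.
Qed.

Lemma natr_ncard (A : set T) : finite_set A ->
  (ncard A)%:R = \sum_(a \in A) (1 : R).
Proof. by move=> fA; rewrite fsbig_finite//= /ncard card_fset_sum1 natr_sum. Qed.

Lemma counting_setI (A B : set T) : finite_set A ->
  (counting (A `&` B) = \sum_(a \in A) (\1_B a : R)%:E :> \bar R)%E.
Proof.
move=> fA; rewrite /counting asboolT; last exact: finite_setIl.
have := natr_ncard (finite_setIl B fA); rewrite /ncard => ->.
rewrite fsbig_mkcondr -fsumEFin//; apply: eq_fsbigr => a _.
by rewrite indicE; case: ifP.
Qed.

Lemma ncard_gt0 (A : set T) : finite_set A -> A !=set0 -> (0 < ncard A)%N.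
Proof.
move=> fA [x Ax]; rewrite /ncard cardfs_gt0; apply/fset0Pn; exists x.
by rewrite in_fset_set// mem_set.
Qed.

Lemma ncard_setX (A : set T) (B : set U) :
  finite_set A -> finite_set B -> ncard (A `*` B) = (ncard A * ncard B)%N.
Proof.
move=> fA fB.
rewrite /ncard fset_setX// -(size_allpairs pair); apply: perm_size.
apply: uniq_perm; [exact: fset_uniq| |].
  by apply: allpairs_uniq => // -[? ?] [? ?].
move=> [x y]; rewrite in_fsetM /=; apply/idP/allpairsP => [/andP[xA yB]|].
  by exists (x, y).
by move=> [[u v] [/= uA vB [-> ->]]]; rewrite uA.
Qed.

End cardinality.

(** * Cancellation, translations and the orbit-stabilizer bijection *)

Section groupoid_theory.
Context (X G : choiceType) (gr : groupoid X G).
Implicit Types (x : X) (g h k : G).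

Lemma ginvK : involutive (ginv gr).
Proof.
move=> g; rewrite -[RHS](gcomp_gidr gr) -src_ginv -gcomp_ginvr.
rewrite gcompA ?src_ginv ?rng_ginv// gcomp_ginvr -rng_ginv -src_ginv.
by rewrite gcomp_gidl.
Qed.

Lemma gcompK g h : rng gr g = src gr h ->
  gcomp gr (ginv gr g) (gcomp gr g h) = h.
Proof.
by move=> gh; rewrite gcompA ?rng_ginv// gcomp_ginvl gh gcomp_gidl.
Qed.

Lemma gcompVK g h : src gr g = src gr h ->
  gcomp gr g (gcomp gr (ginv gr g) h) = h.
Proof. by move=> gh; rewrite -{1}(ginvK g) gcompK// rng_ginv. Qed.

Lemma gcompKr g h : rng gr g = src gr h ->
  gcomp gr (gcomp gr g h) (ginv gr h) = g.
Proof.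
by move=> gh; rewrite -gcompA ?src_ginv// gcomp_ginvr -gh gcomp_gidr.
Qed.

Lemma gcompVKr g h : rng gr g = rng gr h ->
  gcomp gr (gcomp gr g (ginv gr h)) h = g.
Proof. by move=> gh; rewrite -{2}(ginvK h) gcompKr// src_ginv. Qed.

(** Cancel [g] on the left. This is how loops of the Cayley diagram are detected. *)
Lemma gcomp_eql g h : rng gr g = src gr h ->
  gcomp gr g h = g <-> h = gid gr (src gr h).
Proof.
move=> gh; split=> [e|->].
  by rewrite -gh -gcomp_ginvl -{2}e gcompK.
by rewrite -gh gcomp_gidr.
Qed.

Lemma range_gidP g : range (gid gr) g <-> g = gid gr (src gr g).
Proof. by split=> [[x _ <-]|->]; [rewrite src_gid|exists (src gr g)]. Qed.

Lemma ginv_gid x : ginv gr (gid gr x) = gid gr x.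
Proof.
by rewrite -[LHS](gcomp_gidr gr) rng_ginv src_gid gcomp_ginvl rng_gid.
Qed.

(** Left translation by [g] is a bijection between the fibers, undone by translation by
    [ginv gr g]. *)
Lemma card_eq_sfiber_rng g : sfiber gr (rng gr g) #= sfiber gr (src gr g).
Proof.
have <- : gcomp gr g @` sfiber gr (rng gr g) = sfiber gr (src gr g).
  apply/seteqP; split=> [_ [h /= gh <-]|h /= gh].
    by rewrite /sfiber /= src_gcomp.
  exists (gcomp gr (ginv gr g) h); last by rewrite gcompVK.
  by rewrite /sfiber /= src_gcomp ?src_ginv ?rng_ginv.
rewrite card_eq_sym; apply: inj_card_eq => h k /set_mem hg /set_mem kg e.
by rewrite -[h](@gcompK g)// e gcompK.
Qed.

(** Choose a morphism [c y] from [x] to each [y] of the orbit. Then [g] yields its range together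
    with the loop [g] followed by the inverse of [c (rng gr g)]; conversely [(y, h)] comes from [h]
    followed by [c y]. *)
Lemma card_eq_orbit_stab x : sfiber gr x #= gorbit gr x `*` gstab gr x.
Proof.
have /choice[c cP] : forall y, exists g, gorbit gr x y ->
    sfiber gr x g /\ rng gr g = y.
  move=> y; have [[g gx gy]|ny] := pselect (gorbit gr x y).
    by exists g.
  by exists (gid gr x).
pose f g := (rng gr g, gcomp gr g (ginv gr (c (rng gr g)))).
have cr g : sfiber gr x g -> src gr (c (rng gr g)) = x /\
    rng gr (c (rng gr g)) = rng gr g.
  by move=> gx; apply: cP; exists g.
have <- : f @` sfiber gr x = gorbit gr x `*` gstab gr x.
  apply/seteqP; split=> [_ [g gx <-]|[y h] /= [yx [hx hr]]].
    have [cx crg] := cr g gx; split => /=; first by exists g.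
    by split; rewrite /sfiber /rfiber /= ?src_gcomp ?rng_gcomp ?src_ginv ?rng_ginv.
  have [cx cy] := cP y yx.
  have hc : rng gr h = src gr (c y) by rewrite hr cx.
  exists (gcomp gr h (c y)); first by rewrite /sfiber /= src_gcomp.
  by rewrite /f rng_gcomp// cy gcompKr.
rewrite card_eq_sym; apply: inj_card_eq => g h /set_mem gx /set_mem hx [e1 e2].
rewrite -[g](@gcompVKr _ (c (rng gr g))); last by rewrite (cr g gx).2.
by rewrite e2 e1 gcompVKr// (cr h hx).2.
Qed.

Lemma ncard_orbit_stab x :
  (ncard (gorbit gr x) * ncard (gstab gr x))%N = ncard (sfiber gr x).
Proof.
rewrite (card_eq_ncard (card_eq_orbit_stab x)).
have [fx|ix] := pselect (finite_set (sfiber gr x)).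
  by rewrite ncard_setX//; [exact: finite_image|exact: finite_setIl].
(* The fiber is infinite, so the right side is 0. The product being infinite too, one factor is
   infinite and its [ncard] is 0. *)
rewrite -(card_eq_ncard (card_eq_orbit_stab x)) {3}/ncard infinite_fset_set//.
have [fo|io] := pselect (finite_set (gorbit gr x)); last first.
  by rewrite /ncard infinite_fset_set.
have [fs|is_] := pselect (finite_set (gstab gr x)); last first.
  by rewrite {2}/ncard infinite_fset_set// muln0.
by case: ix; rewrite (eq_finite_set (card_eq_orbit_stab x)); exact: finite_setX.
Qed.

End groupoid_theory.

(** * Integrals of almost everywhere equal functions *)

Section integral_congr_ae.
Context d (T : measurableType d) (R : realType).
Variable mu : {measure set T -> \bar R}.

Import HBNNSimple.

(** The integral of [f] is a supremum over simple functions below [f]. Setting such an [h] to 0 on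
    the exceptional null set puts it below [g] and keeps its integral. *)
Let ge0_le_integral_ae_eq (f g : T -> \bar R) :
  (forall x, 0 <= f x)%E -> (forall x, 0 <= g x)%E -> f = g %[ae mu] ->
  (\int[mu]_x f x <= \int[mu]_x g x)%E.
Proof.
move=> f0 g0 [N [mN N0 fgN]].
rewrite [leLHS]ge0_integralTE// [leRHS]ge0_integralTE//.
apply: ge_ereal_sup => _ [h /= hf <-].
apply: ereal_sup_ubound; exists (proj_nnsfun h (measurableC mN)).
  move=> x /=; rewrite mindicE.
  have [xN|] := boolP (x \in ~` N); last by rewrite mulr0.
  rewrite mulr1 (le_trans (hf x))//.
  suff -> : f x = g x by [].
  by apply: contrapT => fgx; move/set_mem: xN; apply; apply: fgN => /= /(_ I).
rewrite -!integralT_nnsfun; apply: ge0_ae_eq_integral => //.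
- exact/measurable_EFinP.
- exact/measurable_EFinP.
- by move=> x _; rewrite lee_fin.
- by move=> x _; rewrite lee_fin.
exists N; split => // x /=; apply: contra_notP => xN _.
by rewrite mindicE mem_set// mulr1.
Qed.

(* Unlike [ae_eq_integral], no measurability is assumed. *)
Lemma integral_congr_ae (f g : T -> \bar R) :
  f = g %[ae mu] -> (\int[mu]_x f x = \int[mu]_x g x)%E.
Proof.
move=> fg.
have [fgp fgn] := (ae_eq_funeposneg mu setT f g).1 fg.
rewrite [LHS]integralE [RHS]integralE; congr (_ - _)%E; apply/eqP;
  rewrite eq_le !ge0_le_integral_ae_eq//; exact: ae_eq_sym.
Qed.

End integral_congr_ae.

(** * Disintegration of the measure on morphisms along the source map *)

Section fiber_measure.
Context (R : realType) dX dG (X : measurableType dX) (G : measurableType dG).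
Variable gr : dm_groupoid R X G.
Local Open Scope ereal_scope.

(** These measures live on all of [G], so that they form a kernel whose integral against
    [obj_measure gr] is [mor_measure gr]. *)
Definition fiber_measure (x : X) (U : set G) : \bar R :=
  counting (sfiber gr x `&` U).

Let fiber_measure0 x : fiber_measure x set0 = 0.
Proof. by rewrite /fiber_measure setI0 /counting asboolT// fset_set0. Qed.

Let fiber_measure_ge0 x U : 0 <= fiber_measure x U.
Proof.
by rewrite /fiber_measure /counting; case: ifPn; rewrite ?lee_fin// lee_pinfty.
Qed.

Let fiber_measure_sigma_additive x : semi_sigma_additive (fiber_measure x).
Proof.
move=> F mF tF mU; rewrite /fiber_measure.
rewrite setI_bigcupr counting_bigcup; last exact: trivIset_setIl.
by apply: is_cvg_ereal_nneg_natsum_cond => n _ _; exact: fiber_measure_ge0.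
Qed.

HB.instance Definition _ x := isMeasure.Build _ G R (fiber_measure x)
  (fiber_measure0 x) (fiber_measure_ge0 x) (@fiber_measure_sigma_additive x).

Lemma measurable_fiber_integral (F : G -> \bar R) :
  (forall g, 0 <= F g) -> measurable_fun setT F ->
  measurable_fun setT (fun x => \int[fiber_measure x]_g F g).
Proof.
move=> F0 mF; apply: (measurable_fun_integral_kernel (l := fiber_measure)) => //.
exact: measurable_scount.
Qed.

Import HBNNSimple.

Let integral_mor_measure_nnsfun (h : {nnsfun G >-> R}) :
  \int[mor_measure gr]_g (h g)%:E =
  \int[obj_measure gr]_x \int[fiber_measure x]_g (h g)%:E.
Proof.
rewrite integralT_nnsfun sintegralE.
under [RHS]eq_integral do rewrite integralT_nnsfun sintegralE.
rewrite ge0_integral_fsum//; last 2 first.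
- move=> r; apply: measurable_funeM; exact: measurable_scount.
- move=> r x _; apply: (mulemu_ge0 (fun r => h @^-1` [set r])) => r0.
  exact: preimage_nnfun0.
apply: eq_fsbigr => r _.
(* A negative [r] has an empty level set, so both sides vanish there. *)
have [r0|r0] := leP 0%R r.
  rewrite ge0_integralZl//; exact: measurable_scount.
rewrite preimage_nnfun0// measure0 mule0 integral0_eq// => x _.
by rewrite measure0 mule0.
Qed.

(** The case of simple functions extends by monotone convergence, applied on [G], on each fiber and
    on the base. *)
Lemma integral_mor_measure (F : G -> \bar R) :
  (forall g, 0 <= F g) -> measurable_fun setT F ->
  \int[mor_measure gr]_g F g =
  \int[obj_measure gr]_x \int[fiber_measure x]_g F g.
Proof.
move=> F0 mF; pose F_ := nnsfun_approx measurableT mF.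
have mF_ n : measurable_fun setT (EFin \o F_ n) by exact/measurable_EFinP.
have F_0 n g : 0 <= (F_ n g)%:E by rewrite lee_fin.
have ndF_ g : {homo (fun n => (F_ n g)%:E) : a b / (a <= b)%N >-> a <= b}.
  by move=> a b ab; rewrite lee_fin; exact/lefP/nd_nnsfun_approx.
have limF g : limn (fun n => (F_ n g)%:E) = F g.
  by apply/cvg_lim => //; exact: cvg_nnsfun_approx.
have MCT (m : {measure set G -> \bar R}) :
    \int[m]_g F g = limn (fun n => \int[m]_g (F_ n g)%:E).
  rewrite -monotone_convergence//.
    by apply: eq_integral => g _; rewrite limF.
rewrite MCT; under eq_fun do rewrite integral_mor_measure_nnsfun.
rewrite -monotone_convergence//.
- by apply: eq_integral => x _; rewrite MCT.
- move=> n; exact: measurable_fiber_integral (F_0 n) (mF_ n).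
- move=> n x _; exact: integral_ge0.
- move=> x _ a b ab; apply: ge0_le_integral => // [||g _].
  + exact: mF_.
  + exact: mF_.
  + exact: ndF_.
Qed.

(** Inversion carries [rfiber gr x] within [U] onto [sfiber gr x] within the preimage of [U]; hence
    [measure_invariant] says that the pushforward by inversion is the same measure. *)
Lemma integral_mor_measure_ginv (F : G -> \bar R) :
  (forall g, 0 <= F g) -> measurable_fun setT F ->
  \int[mor_measure gr]_g F (ginv gr g) = \int[mor_measure gr]_g F g.
Proof.
move=> F0 mF; have mi := measurable_ginv gr.
transitivity (\int[pushforward (mor_measure gr) (ginv gr)]_g F g).
  have F0' : {in setT, forall g, 0 <= F g} by [].
  exact/esym/(ge0_integral_pushforward mi (mor_measure gr) measurableT mF F0').
apply: eq_measure_integral => U mU _.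
rewrite /pushforward /= /mor_measure -[RHS]measure_invariant//.
apply: eq_integral => x _.
apply: card_eq_counting.
have <- : ginv gr @` (rfiber gr x `&` U) = sfiber gr x `&` ginv gr @^-1` U.
  apply/seteqP; split=> [_ [g [gx Ug] <-]|g [gx Ug]].
    by split; rewrite /sfiber /= ?src_ginv ?ginvK.
  by exists (ginv gr g); rewrite ?ginvK//; split => //; rewrite /rfiber/= rng_ginv.
by apply: inj_card_eq => g h _ _; exact: (inv_inj (ginvK gr)).
Qed.

Lemma integral_fiber_measure x (F : G -> \bar R) : finite_set (sfiber gr x) ->
  (forall g, 0 <= F g) -> measurable_fun setT F ->
  \int[fiber_measure x]_g F g = \sum_(g \in sfiber gr x) F g.
Proof.
move=> fx F0 mF; set s := fset_set (sfiber gr x).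
(* The fiber measure is the sum of the Dirac masses at its enumerated points; the default of [nth]
   is never reached for [i < size s]. *)
pose d i : {measure set G -> \bar R} := dirac (nth (gid gr x) s i).
rewrite (eq_measure_integral (msum d (size s))); last first.
  move=> A _ _; rewrite -[LHS]/(counting (sfiber gr x `&` A)) counting_setI//.
  rewrite /msum fsbig_finite//=.
  rewrite (big_nth (gid gr x)) big_mkord; exact: eq_bigr.
rewrite ge0_integral_measure_sum// fsbig_finite//= (big_nth (gid gr x)) big_mkord.
by apply: eq_bigr => i _; rewrite integral_dirac// diracT mul1e.
Qed.

End fiber_measure.

(** * Averaging over fibers preserves integrals *)

Section average.
Context (R : realType) dX dG (X : measurableType dX) (G : measurableType dG).
Variable gr : dm_groupoid R X G.
Hypothesis hfin : finite_groupoid gr.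
Local Notation mu := (obj_measure gr).

Definition fiber_weight (x : X) : R := (ncard (sfiber gr x))%:R^-1.

Lemma fiber_weight_ge0 x : 0 <= fiber_weight x.
Proof. by rewrite invr_ge0. Qed.

(** Both [ncard] of an infinite set and the inverse of 0 are 0. This default makes the identities
    for averages hold at every [x], not just almost everywhere. *)
Lemma infinite_fiber_weight x :
  infinite_set (sfiber gr x) -> fiber_weight x = 0.
Proof.
by move=> ix; rewrite /fiber_weight /ncard infinite_fset_set// invr0.
Qed.

Lemma measurable_fiber_weight : measurable_fun setT fiber_weight.
Proof.
(* The inverse is the real power of exponent [-1], a measurable function; both take the value 0 at
   0. *)
have -> : fiber_weight =
    (@powR R ^~ (-1)) \o (fine \o (fun x => counting (sfiber gr x `&` setT))).
  apply/funext => x; rewrite /= setIT /fiber_weight powR_inv1 ?ncard_fine_counting//.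
  by rewrite -ncard_fine_counting.
apply: measurableT_comp; first exact: measurable_powR.
apply: measurableT_comp; first exact: fine_measurable.
exact: measurable_scount.
Qed.

Lemma fiber_weight_rng g :
  fiber_weight (rng gr g) = fiber_weight (src gr g).
Proof. by rewrite /fiber_weight (card_eq_ncard (card_eq_sfiber_rng gr g)). Qed.

Lemma fsum_fiber_weight x : finite_set (sfiber gr x) ->
  \sum_(g \in sfiber gr x) fiber_weight x = 1.
Proof.
move=> fx; rewrite -[fiber_weight x]mulr1 -mulr_fsumr -natr_ncard//.
rewrite mulVf// pnatr_eq0 -lt0n ncard_gt0//.
by exists (gid gr x); rewrite /sfiber /= src_gid.
Qed.

Definition fiber_average (k : X -> R) (x : X) : R :=
  fiber_weight x * \sum_(g \in sfiber gr x) k (rng gr g).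

Section ge0.
Variable k : X -> R.
Hypotheses (k0 : forall x, 0 <= k x) (mk : measurable_fun setT k).

Let mkr : measurable_fun setT (fun g => (k (rng gr g))%:E).
Proof.
apply/measurable_EFinP.
by apply: (measurableT_comp mk); exact: measurable_rng.
Qed.

Let fiber_average_integral x : (fiber_average k x)%:E =
  ((fiber_weight x)%:E * \int[fiber_measure gr x]_g (k (rng gr g))%:E)%E.
Proof.
have [fx|ix] := pselect (finite_set (sfiber gr x)).
  by rewrite integral_fiber_measure ?fsumEFin// => g; rewrite lee_fin.
by rewrite /fiber_average infinite_fiber_weight// mul0r mul0e.
Qed.

Lemma fiber_average_ge0 x : 0 <= fiber_average k x.
Proof. by rewrite mulr_ge0 ?fiber_weight_ge0// fsumr_ge0. Qed.

Lemma measurable_fiber_average : measurable_fun setT (fiber_average k).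
Proof.
apply/measurable_EFinP.
have -> : EFin \o fiber_average k = (fun x => (fiber_weight x)%:E *
    \int[fiber_measure gr x]_g (k (rng gr g))%:E)%E.
  by apply/funext => x /=; rewrite fiber_average_integral.
apply: emeasurable_funM.
  exact/measurable_EFinP/measurable_fiber_weight.
by apply: measurable_fiber_integral => // g; rewrite lee_fin.
Qed.

(* Mass transport: inversion of the groupoid exchanges source and range and
   leaves the weight of the fibers unchanged. *)
Lemma ge0_integral_fiber_average :
  (\int[mu]_x (fiber_average k x)%:E = \int[mu]_x (k x)%:E)%E.
Proof.
pose F g := (fiber_weight (src gr g) * k (rng gr g))%:E.
have F0 g : (0 <= F g)%E by rewrite lee_fin mulr_ge0// fiber_weight_ge0.
have mF : measurable_fun setT F.
  apply/measurable_EFinP; apply: measurable_funM.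
    apply: (measurableT_comp measurable_fiber_weight); exact: measurable_src.
  apply: (measurableT_comp mk); exact: measurable_rng.
have mFi : measurable_fun setT (F \o ginv gr).
  by apply: measurableT_comp => //; exact: measurable_ginv.
transitivity (\int[mu]_x \int[fiber_measure gr x]_g F g)%E.
  apply: integral_congr_ae; apply: filterS hfin => x fx _.
  rewrite integral_fiber_measure// fsumEFin// /fiber_average mulr_fsumr.
  by congr EFin; apply: eq_fsbigr => g /set_mem <-.
rewrite -integral_mor_measure// -integral_mor_measure_ginv// integral_mor_measure//.
apply: integral_congr_ae; apply: filterS hfin => x fx _.
rewrite (@integral_fiber_measure _ _ _ _ _ _ _ (F \o ginv gr))//=.
rewrite fsumEFin//; congr EFin.
(* After inversion the integrand is constant on the fiber of [x], equal to its weight times [k x],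
   and the weights add up to 1. *)
rewrite -[RHS]mul1r -(fsum_fiber_weight fx) mulr_fsuml.
apply: eq_fsbigr => g /set_mem gx.
by rewrite src_ginv rng_ginv fiber_weight_rng gx.
Qed.

End ge0.

(** Split [k] into positive and negative parts; averaging is linear, and it preserves integrability
    of a nonnegative function because it preserves the integral. *)
Lemma integrable_fiber_average (k : X -> R) :
  mu.-integrable setT (EFin \o k) ->
  mu.-integrable setT (EFin \o fiber_average k) /\
  (\int[mu]_x (fiber_average k x)%:E = \int[mu]_x (k x)%:E)%E.
Proof.
move=> ik; have [/measurable_EFinP mk _] := integrableP _ _ _ ik.
have ikp := integrable_funrpos measurableT ik.
have ikn := integrable_funrneg measurableT ik.
have kE : (fun x => (k x)%:E) = (fun x => (k^\+ x)%:E - (k^\- x)%:E)%E.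
  by apply/funext => x; rewrite -EFinB -[in LHS](funrposBneg k).
have AE : (fun x => (fiber_average k x)%:E) =
    (fun x => (fiber_average k^\+ x)%:E - (fiber_average k^\- x)%:E)%E.
  apply/funext => x; rewrite -EFinB; congr EFin.
  have [fx|ix] := pselect (finite_set (sfiber gr x)); last first.
    by rewrite /fiber_average infinite_fiber_weight// !mul0r subrr.
  rewrite /fiber_average -mulrBr !fsbig_finite//= -sumrB; congr (_ * _).
  by apply: eq_bigr => g _; rewrite -[in LHS](funrposBneg k).
have iA (h : X -> R) : (forall x, 0 <= h x) -> mu.-integrable setT (EFin \o h) ->
    mu.-integrable setT (EFin \o fiber_average h).
  move=> h0 /integrableP[/measurable_EFinP mh hoo]; apply/integrableP; split.
    by apply/measurable_EFinP; exact: measurable_fiber_average.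
  move: hoo; under eq_integral do rewrite /= ger0_norm//.
  rewrite -ge0_integral_fiber_average//.
  by under [in X in _ -> X]eq_integral do rewrite /= ger0_norm ?fiber_average_ge0//.
have iAp := iA _ (funrpos_ge0 k) ikp.
have iAn := iA _ (funrneg_ge0 k) ikn.
split; first by rewrite [EFin \o _]AE; exact: integrableB.
rewrite AE kE !integralB_EFin// !ge0_integral_fiber_average//.
- exact: measurable_funrneg.
- exact: measurable_funrpos.
Qed.

End average.

(** * The trace and the diagonal of the convolution operators *)

Section groupoid_trace.
Context (R : realType) dX dG (X : measurableType dX) (G : measurableType dG).
Variable gr : dm_groupoid R X G.
Hypothesis hfin : finite_groupoid gr.
Local Notation mu := (obj_measure gr).
Local Notation muG := (mor_measure gr).

Let measurable_units : measurable (range (gid gr)).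
Proof. exact: measurable_range_gid. Qed.

Let measurable_src_units (k : X -> R) : measurable_fun setT k ->
  measurable_fun setT (fun g => k (src gr g) * \1_(range (gid gr)) g).
Proof.
move=> mk; apply: measurable_funM; last exact: measurable_indic.
by apply: (measurableT_comp mk); exact: measurable_src.
Qed.

(** The units meet the fiber of [x] in the single point [gid gr x], so the fiber sum reduces to one
    term. *)
Let ge0_integral_units (k : X -> R) :
  (forall x, 0 <= k x) -> measurable_fun setT k ->
  (\int[muG]_g (k (src gr g) * \1_(range (gid gr)) g)%:E =
   \int[mu]_x (k x)%:E)%E.
Proof.
move=> k0 mk.
have F0 g : (0 <= (k (src gr g) * \1_(range (gid gr)) g)%:E)%E.
  by rewrite lee_fin mulr_ge0.
have mF := measurable_src_units mk.
rewrite integral_mor_measure//; last exact/measurable_EFinP.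
apply: integral_congr_ae; apply: filterS hfin => x fx _.
rewrite integral_fiber_measure//; last exact/measurable_EFinP.
rewrite fsumEFin//; congr EFin.
rewrite -(@fsbig_widen _ _ _ _ [set gid gr x])//=; last 2 first.
- by move=> _ ->; rewrite /sfiber /= src_gid.
- move=> g [/= gx gNx]; rewrite indicE memNset ?mulr0// => /range_gidP.
  by rewrite gx.
by rewrite fsbig_set1 src_gid indicE mem_set ?mulr1//; exists x.
Qed.

(** Multiplication by an indicator commutes with positive and negative parts, which reduces to the
    nonnegative case. *)
Lemma integral_units (k : X -> R) : measurable_fun setT k ->
  (\int[muG]_g (k (src gr g) * \1_(range (gid gr)) g)%:E =
   \int[mu]_x (k x)%:E)%E.
Proof.
move=> mk; set u := \1_(range (gid gr)).
have posE : (fun g => k (src gr g) * u g)^\+ = fun g => (k^\+)%R (src gr g) * u g.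
  apply/funext => g; rewrite /funrpos /u indicE.
  by case: (_ \in _); rewrite ?mulr1// !mulr0 maxxx.
have negE : (fun g => k (src gr g) * u g)^\- = fun g => (k^\-)%R (src gr g) * u g.
  apply/funext => g; rewrite /funrneg /u indicE.
  by case: (_ \in _); rewrite ?mulr1// !mulr0 oppr0 maxxx.
rewrite [LHS]integralE [RHS]integralE; congr (_ - _)%E.
- rewrite (funerpos (fun g => k (src gr g) * u g)) (funerpos k) posE.
  by apply: ge0_integral_units => //; exact: measurable_funrpos.
- rewrite (funerneg (fun g => k (src gr g) * u g)) (funerneg k) negE.
  by apply: ge0_integral_units => //; exact: measurable_funrneg.
Qed.

Lemma chi0E g : chi0 gr g = (\1_(range (gid gr)) g)%:C%C.
Proof. by rewrite /chi0 indicE; case: (_ \in _). Qed.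

Lemma L2_chi0 : L2 gr (chi0 gr).
Proof.
split; first split.
- under eq_fun do rewrite chi0E /=.
  exact: measurable_indic.
- under eq_fun do rewrite chi0E /=.
  exact: measurable_cst.
(* As [chi0] is 0 or 1, its squared modulus is the indicator of the units, whose integral is the
   finite mass of [X]. *)
rewrite (eq_integral (fun g => (1 * \1_(range (gid gr)) g)%:E)); last first.
  move=> g _; rewrite mul1r chi0E indicE /= expr0n addr0 sqrtr_sqr.
  rewrite real_normK ?num_real//.
  by case: (_ \in _); rewrite ?expr1n ?expr0n.
rewrite (integral_units (k := cst 1))//=.
by rewrite integral_cst// mul1e; exact: fin_num_fun_lty.
Qed.

Definition edge_fix (phi : measurable_edge gr) : set X :=
  [set x | edge_dom phi x /\ phi x = gid gr x].

Lemma measurable_edge_fix phi : measurable (edge_fix phi).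
Proof.
(* A unit [phi x] can only be the one at its source, which is [x]. *)
have -> : edge_fix phi = edge_dom phi `&` phi @^-1` range (gid gr).
  apply/seteqP; split=> x [dx /= px]; split => //=; first by rewrite px; exists x.
  by move/range_gidP : px; rewrite src_edge.
apply: measurable_edge_fun => //; exact: measurable_edge_dom.
Qed.

(** Injectivity of the range on the edge forces the preimage chosen in [edge_inv] to be [x]. *)
Lemma edge_inv_rng (phi : measurable_edge gr) x : edge_dom phi x ->
  edge_inv phi (rng gr (phi x)) = ginv gr (phi x).
Proof.
move=> dx; rewrite /edge_inv; congr (ginv gr (phi _)).
exact: (pinvKV _ (@rng_edge_inj _ _ _ _ _ _ phi) (mem_set dx)).
Qed.

(** At the unit of [x] the operator evaluates [chi0] at the inverse edge from [x], which is a unit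
    exactly when [phi] fixes [x]. *)
Lemma edge_op_chi0 (phi : measurable_edge gr) (f : X -> R[i]) x :
  edge_op phi (mul_op gr f (chi0 gr)) (gid gr x) =
  f x * (\1_(edge_fix phi) x)%:C%C.
Proof.
rewrite /edge_op rng_gid; have [xfix|xNfix] := pselect (edge_fix phi x).
  have [dx px] := xfix; rewrite ifT; last first.
    by rewrite inE; exists (gid gr x); [exists x|rewrite rng_gid].
  have -> : edge_inv phi x = gid gr x.
    by have := edge_inv_rng dx; rewrite px rng_gid ginv_gid.
  have -> : gcomp gr (gid gr x) (gid gr x) = gid gr x.
    by rewrite -{1}(src_gid gr x) gcomp_gidl.
  by rewrite /mul_op rng_gid chi0E !indicE !mem_set//; exists x.
rewrite indicE [x \in edge_fix _]memNset// mulr0n rmorph0 mulr0.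
case: ifPn => //; rewrite inE => -[_ [y dy <-] yx].
(* Now [x] is the range of [phi y]. Were the inverse of [phi y] a unit, so would be [phi y]; then
   [y = x] and [phi] would fix [x]. *)
rewrite -{}yx in xNfix *; rewrite edge_inv_rng// -src_ginv gcomp_gidl.
rewrite /mul_op chi0E indicE memNset ?mulr0n ?rmorph0 ?mulr0//.
move=> /range_gidP; rewrite src_ginv => e; apply: xNfix.
have py : phi y = gid gr (rng gr (phi y)) by rewrite -[LHS](ginvK gr) e ginv_gid.
have ry : rng gr (phi y) = y by rewrite -[RHS](src_edge dy) [in RHS]py src_gid.
by rewrite ry; split => //; rewrite py ry.
Qed.

Section presentation.
Variables (n : nat) (phi : 'I_n -> measurable_edge gr) (f : 'I_n -> X -> R[i]).
Hypothesis hf : forall i, Linfty gr (f i).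

(** The conditional expectation of the operator onto functions on the objects: its value on [chi0],
    restricted to the units. *)
Definition unit_coef (x : X) : R[i] :=
  \sum_(i < n) f i x * (\1_(edge_fix (phi i)) x)%:C%C.

Lemma sum_op_chi0 g :
  sum_op phi f (chi0 gr) g * conjc (chi0 gr g) =
  unit_coef (src gr g) * (\1_(range (gid gr)) g)%:C%C.
Proof.
rewrite chi0E indicE; case: (boolP (g \in _)) => [|_]; last first.
  by rewrite !mulr0 raddf0 mulr0.
rewrite inE => -[x _ <-]; rewrite src_gid rmorph1 !mulr1.
by apply: eq_bigr => i _; exact: edge_op_chi0.
Qed.

(** By [gcomp_eql], the edge leaving [a] returns to [a] exactly when [phi i] is the identity at the
    range of [a]. *)
Lemma conv_zeta_diag a : conv_zeta phi f a a = unit_coef (rng gr a).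
Proof.
rewrite /conv_zeta big_mkcond; apply: eq_bigr => i _; rewrite indicE.
have [|dNa] := boolP (rng gr a \in edge_dom (phi i)); last first.
  rewrite memNset ?mulr0n ?rmorph0 ?mulr0// => -[da _].
  by rewrite mem_set in dNa.
rewrite inE => da; rewrite /zeta; congr (_ * _).
have sa : rng gr a = src gr (phi i (rng gr a)) by rewrite src_edge.
have [/esym/(gcomp_eql sa) e|ne] := eqVneq a.
  by rewrite mem_set//; split => //; rewrite e -sa.
rewrite memNset// => -[_ e]; move/eqP: ne; apply; apply/esym/(gcomp_eql sa).
by rewrite -sa.
Qed.

Lemma fiber_trace_conv_op x :
  fiber_trace gr x (conv_op phi f x) =
  \sum_(a \in sfiber gr x) unit_coef (rng gr a).
Proof.
apply: eq_fsbigr => a /set_mem ax; rewrite /conv_op.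
rewrite -(@fsbig_widen _ _ _ _ [set a])//=; last 2 first.
- by move=> _ ->.
- by move=> b [_ /= /eqP/negPf ab]; rewrite /zeta ab mul0r.
by rewrite fsbig_set1 /zeta eqxx mul1r conv_zeta_diag.
Qed.

Let normr_Re_normc (z : R[i]) : `|complex.Re z| <= Normc.normc z.
Proof.
by case: z => a b /=; rewrite -sqrtr_sqr ler_wsqrtr// lerDl sqr_ge0.
Qed.

Let normr_Im_normc (z : R[i]) : `|complex.Im z| <= Normc.normc z.
Proof.
by case: z => a b /=; rewrite -sqrtr_sqr ler_wsqrtr// lerDr sqr_ge0.
Qed.

Let integrable_ae_bounded (k : X -> R) (M : R) : measurable_fun setT k ->
  {ae mu, forall x, `|k x| <= M} -> mu.-integrable setT (EFin \o k).
Proof.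
move=> mk kM; apply/integrableP; split; first exact/measurable_EFinP.
(* The bound [M] may be negative when [mu] is zero, hence its absolute value. *)
apply: (@le_lt_trans _ _ (\int[mu]_x `|M|%:E)%E); last first.
  by rewrite integral_cst// lte_mul_pinfty ?lee_fin//; exact: fin_num_fun_lty.
apply: ae_ge0_le_integral => //.
- by apply: measurableT_comp => //; exact/measurable_EFinP.
- by apply: filterS kM => x kxM _; rewrite /= lee_fin (le_trans kxM)// ler_norm.
Qed.

Lemma cintegrable_unit_coef : cintegrable mu unit_coef.
Proof.
(* The indicators are real, so the real and imaginary parts both have this form, with [k i] the
   corresponding part of [f i]. *)
have ind (k : 'I_n -> X -> R) :
    (forall i, measurable_fun setT (k i)) ->
    (forall i x, `|k i x| <= Normc.normc (f i x)) ->
    mu.-integrable setT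
      (fun x => (\sum_(i < n) k i x * \1_(edge_fix (phi i)) x)%:E).
  move=> mk kf; under eq_fun do rewrite -sumEFin.
  apply: integrable_sum => // i _; have [_ [M fM]] := hf i.
  apply: (@integrable_ae_bounded _ M).
    apply: measurable_funM => //; apply: measurable_indic.
    exact: measurable_edge_fix.
  apply: filterS fM => x fxM; apply: le_trans fxM.
  rewrite indicE normrM; apply: le_trans (kf i x).
  by rewrite ler_piMr// normr_nat lern1 leq_b1.
have fm i := (hf i).1.
split.
- rewrite (_ : (fun _ => _) = (fun x =>
    (\sum_(i < n) complex.Re (f i x) * \1_(edge_fix (phi i)) x)%:E)).
    by apply: ind => [i|i x]; [exact: (fm i).1|exact: normr_Re_normc].
  apply/funext => x; rewrite /unit_coef raddf_sum; congr EFin.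
  by apply: eq_bigr => i _; case: (f i x) => a b /=; rewrite mulr0 subr0.
- rewrite (_ : (fun _ => _) = (fun x =>
    (\sum_(i < n) complex.Im (f i x) * \1_(edge_fix (phi i)) x)%:E)).
    by apply: ind => [i|i x]; [exact: (fm i).2|exact: normr_Im_normc].
  apply/funext => x; rewrite /unit_coef raddf_sum; congr EFin.
  by apply: eq_bigr => i _; case: (f i x) => a b /=; rewrite mulr0 add0r.
Qed.

(** Since [chi0] is in L^2, [T chi0] is determined almost everywhere. This representative may fail
    to be measurable, which is why [integral_congr_ae] is used. *)
Lemma gtrace_unit_coef T : L2_op_eq gr T (sum_op phi f) ->
  gtrace gr T = cintegral mu unit_coef.
Proof.
move=> hT; have Tchi := hT _ L2_chi0.
have [iRe iIm] := cintegrable_unit_coef.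
have [/measurable_EFinP mRe _] := integrableP _ _ _ iRe.
have [/measurable_EFinP mIm _] := integrableP _ _ _ iIm.
rewrite /gtrace /L2_dot /cintegral /Rintegral.
congr (Complex (fine _) (fine _)).
- rewrite -(integral_units mRe); apply: integral_congr_ae.
  apply: filterS Tchi => g /(_ I) -> _; rewrite sum_op_chi0.
  by case: (unit_coef _) => a b /=; rewrite mulr0 subr0.
- rewrite -(integral_units mIm); apply: integral_congr_ae.
  apply: filterS Tchi => g /(_ I) -> _; rewrite sum_op_chi0.
  by case: (unit_coef _) => a b /=; rewrite mulr0 add0r.
Qed.

End presentation.

Lemma cintegral_fiber_average (K : X -> R[i]) : cintegrable mu K ->
  let A x := 1 / (ncard (sfiber gr x))%:R * \sum_(a \in sfiber gr x) K (rng gr a) in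
  cintegrable mu A /\ cintegral mu A = cintegral mu K.
Proof.
move=> [iRe iIm] A.
have [iARe ARe] := integrable_fiber_average hfin iRe.
have [iAIm AIm] := integrable_fiber_average hfin iIm.
have wE x : 1 / (ncard (sfiber gr x))%:R = (fiber_weight gr x)%:C%C.
  by rewrite div1r fmorphV rmorph_nat.
have AE x : A x = Complex (fiber_average gr (fun y => complex.Re (K y)) x)
                          (fiber_average gr (fun y => complex.Im (K y)) x).
  rewrite /A wE /fiber_average.
  (* A sum with infinite support is 0 by convention and need not commute with real and imaginary
     parts; on infinite fibers the zero weight settles the equality. *)
  have [fx|ix] := pselect (finite_set (sfiber gr x)); last first.
    by rewrite infinite_fiber_weight// rmorph0 !mul0r.
  rewrite !fsbig_finite//= -(raddf_sum (@complex.Re R)) -(raddf_sum (@complex.Im R)).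
  by case: (\sum_(i <- _) _) => a b; apply/eqP;
    rewrite eq_complex /= !mul0r subr0 addr0 !eqxx.
have ReA : (fun x => complex.Re (A x)) = fiber_average gr (fun y => complex.Re (K y)).
  by apply/funext => x; rewrite AE.
have ImA : (fun x => complex.Im (A x)) = fiber_average gr (fun y => complex.Im (K y)).
  by apply/funext => x; rewrite AE.
split.
  by split; [rewrite -ReA in iARe|rewrite -ImA in iAIm].
by rewrite /cintegral /Rintegral -ARe -AIm -ReA -ImA//.
Qed.

End groupoid_trace.

Theorem corollary2p11 (R : realType) (dX dG : measure_display)
    (X : measurableType dX) (G : measurableType dG)
    (gr : dm_groupoid R X G) (hfin : finite_groupoid gr)
    (T : (G -> R[i]) -> G -> R[i]) (hT : groupoid_ring gr T)
    (n : nat) (phi : 'I_n -> measurable_edge gr) (f : 'I_n -> X -> R[i])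
    (hf : forall i, Linfty gr (f i)) (hTrep : L2_op_eq gr T (sum_op phi f)) :
  let trT (x : X) := fiber_trace gr x (conv_op phi f x) in
  let I1 (x : X) :=
    1 / ((ncard (gorbit gr x))%:R * (ncard (gstab gr x))%:R) * trT x in
  let I2 (x : X) := 1 / (ncard (sfiber gr x))%:R * trT x in
  [/\ cintegrable (obj_measure gr) I1,
      cintegrable (obj_measure gr) I2,
      gtrace gr T = cintegral (obj_measure gr) I1 &
      cintegral (obj_measure gr) I1 = cintegral (obj_measure gr) I2].
Proof.
move=> trT I1 I2.
(* The integrands agree at every point, infinite fibers included. *)
have -> : I1 = I2.
  by apply/funext => x; rewrite /I1 -natrM ncard_orbit_stab.
have [iI2 eI2] := cintegral_fiber_average hfin (cintegrable_unit_coef phi hf).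
have I2E : I2 = fun x => 1 / (ncard (sfiber gr x))%:R *
    \sum_(a \in sfiber gr x) unit_coef phi f (rng gr a).
  by apply/funext => x; rewrite /I2 /trT fiber_trace_conv_op.
by split => //; rewrite I2E// eI2; exact: gtrace_unit_coef.
Qed.
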